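(* Let $E=\mathbb{F}^n$ for a field $\mathbb{F}$, and let $\mathcal{H}$ and $\mathcal{C}^*$ be collections of subspaces of $E$ with $\mathcal{C}^*=\{H^\perp: H\in\mathcal{H}\}$. Then $\mathcal{H}$ satisfies the hyperplane axioms (H1)–(H3) if and only if $\mathcal{C}^*$ satisfies the circuit axioms (C1)–(C3).
   Context: $X^\perp=\{y\in E: x\cdot y=0\ \forall x\in X\}$ with respect to the standard dot product. Hyperplane axioms: (H1) $E\notin\mathcal{H}$; (H2) $H_1\subseteq H_2$ in $\mathcal{H}$ implies $H_1=H_2$; (H3) for all distinct $H_1,H_2\in\mathcal{H}$ and every $1$-dimensional subspace $x$ there is $H_3\in\mathcal{H}$ with $(H_1\cap H_2)+x\subseteq H_3$. Circuit axioms for $\mathcal{C}$: (C1) $\{0\}\notin\mathcal{C}$; (C2) $C_1\subseteq C_2$ in $\mathcal{C}$ implies $C_1=C_2$; (C3) for all distinct $C_1,C_2\in\mathcal{C}$ and every subspace $X$ of codimension $1$ in $E$ there is $C_3\in\mathcal{C}$ with $C_3\subseteq(C_1+C_2)\cap X$. *)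

(* Defs.v *)
From HB Require Import structures.
From mathcomp Require Import all_boot all_order all_algebra.
From mathcomp Require Import boolp classical_sets.

Set Implicit Arguments.
Unset Strict Implicit.
Unset Printing Implicit Defensive.

Import GRing.Theory.
Local Open Scope ring_scope.

Section DotProduct.
Variables (F : fieldType) (n : nat).

Definition dotv (u v : 'rV[F]_n) : F := \sum_(i < n) u 0 i * v 0 i.

(* A symmetric bilinear form is, for the library, a Hermitian form with
   trivial sign and trivial conjugation; no positivity is involved, so
   nonzero self-orthogonal vectors are allowed. *)
Fact dotv_bilinear : bilinear_for *%R (idfun \; *%R) dotv.
Proof.
split=> [v a u1 u2 | u a v1 v2]; rewrite /dotv /= mulr_sumr -big_split /=;
  apply: eq_bigr => i _; rewrite !mxE.
  by rewrite mulrDl mulrA.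
by rewrite mulrDr mulrCA.
Qed.

HB.instance Definition _ :=
  bilinear_isBilinear.Build F 'rV[F]_n 'rV[F]_n F *%R (idfun \; *%R) dotv
    dotv_bilinear.

Fact dotv_sym u v : dotv u v = (-1) ^+ false * idfun (dotv v u).
Proof. by rewrite mul1r; apply: eq_bigr => i _; rewrite mulrC. Qed.

HB.instance Definition _ :=
  isHermitianSesquilinear.Build F 'rV[F]_n false idfun dotv dotv_sym.

Definition perpv (X : {vspace 'rV[F]_n}) : {vspace 'rV[F]_n} := orthov dotv X.

Lemma mem_perpvP (X : {vspace 'rV[F]_n}) (y : 'rV[F]_n) :
  reflect (forall x, x \in X -> dotv x y = 0) (y \in perpv X).
Proof.
have dotC u v : dotv u v = dotv v u by rewrite dotv_sym mul1r.
by apply: (iffP mem_orthovP) => Xy x /Xy; rewrite dotC.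
Qed.

End DotProduct.

Local Open Scope vspace_scope.

Section HyperplanesAndCircuits.
Variables (F : fieldType) (E : vectType F).
Implicit Types (HH CC : set {vspace E}).

Definition hyperplane1 HH : Prop := ~ HH fullv.

Definition hyperplane2 HH : Prop :=
  forall H1 H2, HH H1 -> HH H2 -> (H1 <= H2) -> H1 = H2.

Definition hyperplane3 HH : Prop :=
  forall H1 H2, HH H1 -> HH H2 -> H1 <> H2 ->
  forall x : {vspace E}, \dim x = 1%N ->
  exists2 H3, HH H3 & (H1 :&: H2 + x <= H3).

Definition hyperplane_axioms HH : Prop :=
  [/\ hyperplane1 HH, hyperplane2 HH & hyperplane3 HH].

Definition circuit1 CC : Prop := ~ CC 0%VS.

Definition circuit2 CC : Prop :=
  forall C1 C2, CC C1 -> CC C2 -> (C1 <= C2) -> C1 = C2.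

(* Codimension 1 is stated additively: with the truncated predecessor,
   the zero space would count as having codimension 1 in itself. *)
Definition circuit3 CC : Prop :=
  forall C1 C2, CC C1 -> CC C2 -> C1 <> C2 ->
  forall X : {vspace E}, (\dim X + 1)%N = \dim {:E} ->
  exists2 C3, CC C3 & (C3 <= (C1 + C2) :&: X).

Definition circuit_axioms CC : Prop :=
  [/\ circuit1 CC, circuit2 CC & circuit3 CC].

End HyperplanesAndCircuits.

(* Main.v *)
(* Since the dot product is nondegenerate, [perpv] is an inclusion-reversing
   involution of the lattice of subspaces: it exchanges sum and intersection,
   0 and E, dimension 1 and codimension 1, hence each hyperplane axiom with
   the corresponding circuit axiom. *)
Require Import Defs.
From mathcomp Require Import all_boot all_order all_algebra.
From mathcomp Require Import boolp classical_sets.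

Local Open Scope classical_set_scope.

Import GRing.Theory.

Section Perp.
Local Open Scope ring_scope.
Context {F : fieldType} {n : nat}.
Implicit Types (U V : {vspace 'rV[F]_n}) (HH : set {vspace 'rV[F]_n}).

(* [perpv V] is the kernel of x |-> x *m A^T, where the rows of A form a basis
   of V; this map is onto since A has full row rank. *)
Lemma dim_perpv V : (\dim (perpv V) + \dim V)%N = n.
Proof.
pose b := vbasis V; pose A : 'M[F]_(\dim V, n) := \matrix_i b`_i.
have A_free : row_free A.
  apply: inj_row_free => u uA0.
  have /freeP b_free := basis_free (vbasisP V).
  apply/rowP => i; rewrite mxE; apply: b_free i.
  rewrite -[RHS]uA0 mulmx_sum_row.
  by apply: eq_bigr => i _; rewrite rowK.
pose f := linfun (mulmxr A^T : 'rV[F]_n -> 'rV[F]_(\dim V)).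
have kerf : lker f = perpv V.
  apply/vspaceP => x; rewrite memv_ker lfunE /=.
  have xAE (i : 'I_(\dim V)) : (x *m A^T) 0 i = dotv b`_i x.
    rewrite mxE; apply: eq_bigr => j _; rewrite !mxE; exact: mulrC.
  apply/eqP/mem_perpvP => [xA0 v vV | xV].
    rewrite (coord_vbasis vV) linear_sumlz big1 // => i _.
    by rewrite linearZl_LR /= -/b -xAE xA0 mxE mulr0.
  apply/rowP => i; rewrite xAE mxE; apply/xV/vbasis_mem/mem_nth.
  by rewrite size_tuple.
have imf : limg f = fullv.
  apply/vspaceP => w; rewrite memvf.
  have A_full : row_full A^T by rewrite /row_full mxrank_tr.
  have -> : w = f (w *m pinvmx A^T) by rewrite lfunE /= mulmxKpV ?submx_full.
  by rewrite memv_img ?memvf.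
by have := limg_ker_dim f fullv; rewrite imf capfv kerf !dimvf /dim /= !mul1n.
Qed.

Lemma perpv_sym U V : (U <= perpv V)%VS = (V <= perpv U)%VS.
Proof. exact: orthov_sym. Qed.

(** Symmetry of the form gives [V <= perpv (perpv V)], and two uses of [dim_perpv] give equal
    dimensions. No direct sum decomposition is used: [V] may meet [perpv V] nontrivially. *)
Lemma perpvK : involutive (@perpv F n).
Proof.
move=> V; apply/esym/eqP; rewrite eqEdim perpv_sym subvv /=.
by rewrite -(leq_add2l (\dim (perpv V))) dim_perpv addnC dim_perpv.
Qed.

Lemma perpvS U V : (perpv U <= perpv V)%VS = (V <= U)%VS.
Proof. by rewrite perpv_sym perpvK. Qed.

Lemma perpv0 : perpv 0%VS = fullv :> {vspace 'rV[F]_n}.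
Proof. exact: orthov0. Qed.

Lemma perpvD U V : perpv (U + V) = (perpv U :&: perpv V)%VS.
Proof.
apply/subv_anti/andP; split; first by rewrite subv_cap !perpvS addvSl addvSr.
by rewrite /perpv orthovD capvSl capvSr.
Qed.

Lemma perpvI U V : perpv (U :&: V) = (perpv U + perpv V)%VS.
Proof. by apply: (inv_inj perpvK); rewrite perpvD !perpvK. Qed.

(** Holds because [perpv] is its own inverse; it turns each hypothesis or goal about circuits into
    one about [HH]. *)
Lemma image_perpv HH V : [set perpv H | H in HH] V = HH (perpv V).
Proof.
apply/propext; split=> [[H HHH <-] | HHV]; first by rewrite perpvK.
by exists (perpv V); rewrite ?perpvK.
Qed.

Lemma circuit1_perpv HH : circuit1 [set perpv H | H in HH] <-> hyperplane1 HH.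
Proof. by rewrite /circuit1 image_perpv perpv0. Qed.

Lemma circuit2_perpv HH : circuit2 [set perpv H | H in HH] <-> hyperplane2 HH.
Proof.
split=> ax U V.
  (* Duality reverses the inclusion, so the axiom is applied with [U] and [V] exchanged. *)
  move=> HU HV UV; apply/esym/(inv_inj perpvK).
  by apply: ax; rewrite ?image_perpv ?perpvK ?perpvS.
rewrite !image_perpv => CU CV UV; apply/esym/(inv_inj perpvK).
by apply: ax; rewrite ?perpvS.
Qed.

Lemma circuit3_perpv HH : circuit3 [set perpv H | H in HH] <-> hyperplane3 HH.
Proof.
have dimE : \dim {: 'rV[F]_n} = n by rewrite dimvf /dim /= mul1n.
split=> ax U V.
  move=> HU HV neqUV x dimx.
  have [||||W] := ax (perpv U) (perpv V) _ _ _ (perpv x).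
  - by rewrite image_perpv perpvK.
  - by rewrite image_perpv perpvK.
  - by move/(inv_inj perpvK).
  - by have := dim_perpv x; rewrite dimE dimx.
  (* The bound on the circuit [W] is [(perpv U + perpv V) :&: perpv x], which is
     [perpv (U :&: V + x)]; hence [perpv W] is the hyperplane sought. *)
  rewrite image_perpv -perpvI -perpvD => HW WUV.
  by exists (perpv W); rewrite // perpv_sym.
rewrite !image_perpv => HU HV neqUV X dimX.
have [||W HW] := ax _ _ HU HV _ (perpv X).
- by move/(inv_inj perpvK).
(* [perpv X] is a line: adding [\dim X] to its dimension or to 1 gives [n] either way. *)
- by apply/(@addnI (\dim X)); rewrite dimX dimE addnC dim_perpv.
rewrite -perpvD -perpvI => UVW.
by exists (perpv W); rewrite ?image_perpv ?perpvK // -perpvS perpvK.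
Qed.

End Perp.

Theorem theorem73 (F : fieldType) (n : nat)
    (HH Cstar : set {vspace 'rV[F]_n})
    (Cstar_def : Cstar = [set perpv H | H in HH]) :
  hyperplane_axioms HH <-> circuit_axioms Cstar.
Proof.
rewrite {}Cstar_def; split=> -[ax1 ax2 ax3]; split.
- exact/circuit1_perpv.
- exact/circuit2_perpv.
- exact/circuit3_perpv.
- exact/circuit1_perpv.
- exact/circuit2_perpv.
- exact/circuit3_perpv.
Qed.
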